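(* Let $(H,\beta)$ be a Hom-bialgebra over a field $K$ and let $(M,\rhd_M,\rho^M,\alpha_M)$ and $(N,\rhd_N,\rho^N,\alpha_N)$ be (left-left) Hom-Yetter-Drinfeld modules over $(H,\beta)$. For any two Hom-Yetter-Drinfeld modules $M,N$ over $(H,\beta)$ define the linear map $$\tau_{M,N}:M\otimes N\to N\otimes M,\qquad m\otimes n\mapsto \bigl(\beta^3(m_{-1})\rhd_N n\bigr)\otimes m_0 .$$ Then $\tau_{M,N}\circ(\alpha_M\otimes\alpha_N)=(\alpha_N\otimes\alpha_M)\circ\tau_{M,N}$, and if $(P,\rhd_P,\rho^P,\alpha_P)$ is also a Hom-Yetter-Drinfeld module over $(H,\beta)$, then the maps $\tau$ satisfy the Hom-Yang-Baxter equation $$(\alpha_P\otimes\tau_{M,N})\circ(\tau_{M,P}\otimes\alpha_N)\circ(\alpha_M\otimes\tau_{N,P})=(\tau_{N,P}\otimes\alpha_M)\circ(\alpha_N\otimes\tau_{M,P})\circ(\tau_{M,N}\otimes\alpha_P)$$ as maps $M\otimes N\otimes P\to P\otimes N\otimes M$.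
   Context: All spaces are over a field $K$. Sweedler-type notation: $\Delta(c)=c_1\otimes c_2$, $\Delta(c_1)=c_{11}\otimes c_{12}$, etc., summation understood. Hom-algebra $(A,\mu,1_A,\alpha)$ (abbr. $(A,\alpha)$): a vector space $A$, a linear map $\mu:A\otimes A\to A$, $a\otimes a'\mapsto aa'$, an element $1_A\in A$ and a bijective linear map $\alpha:A\to A$ with $\alpha(aa')=\alpha(a)\alpha(a')$, $\alpha(1_A)=1_A$, $\alpha(a)(a'a'')=(aa')\alpha(a'')$, $a1_A=1_Aa=\alpha(a)$. Hom-coalgebra $(C,\Delta,\varepsilon_C,\beta)$ (abbr. $(C,\beta)$): a vector space $C$, linear maps $\Delta:C\to C\otimes C$, $\varepsilon_C:C\to K$ and a bijective linear map $\beta:C\to C$ with $\Delta(\beta(c))=\beta(c_1)\otimes\beta(c_2)$, $\varepsilon_C\circ\beta=\varepsilon_C$, $\beta(c_1)\otimes c_{21}\otimes c_{22}=c_{11}\otimes c_{12}\otimes\beta(c_2)$, $\varepsilon_C(c_1)c_2=c_1\varepsilon_C(c_2)=\beta(c)$. Hom-bialgebra $(H,\mu,1_H,\Delta,\varepsilon,\beta)$ (abbr. $(H,\beta)$): $(H,\mu,1_H,\beta)$ is a Hom-algebra, $(H,\Delta,\varepsilon,\beta)$ is a Hom-coalgebra, and $\Delta(hh')=h_1h'_1\otimes h_2h'_2$, $\Delta(1_H)=1_H\otimes1_H$, $\varepsilon(hh')=\varepsilon(h)\varepsilon(h')$, $\varepsilon(1_H)=1$. Left $(H,\beta)$-Hom-module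 $(M,\rhd,\alpha)$ over a Hom-algebra $(H,\beta)$: a vector space $M$, a linear map $\rhd:H\otimes M\to M$ and a bijective linear map $\alpha:M\to M$ with $\alpha(h\rhd m)=\beta(h)\rhd\alpha(m)$, $\beta(h)\rhd(h'\rhd m)=(hh')\rhd\alpha(m)$, $1_H\rhd m=\alpha(m)$. Left $(H,\beta)$-Hom-comodule $(M,\rho,\alpha)$ over a Hom-coalgebra $(H,\beta)$: a vector space $M$, a linear map $\rho:M\to H\otimes M$, $\rho(m)=m_{-1}\otimes m_0$, and a bijective linear map $\alpha:M\to M$ with $\rho(\alpha(m))=\beta(m_{-1})\otimes\alpha(m_0)$, $\beta(m_{-1})\otimes m_{0\,-1}\otimes m_{0\,0}=m_{-1\,1}\otimes m_{-1\,2}\otimes\alpha(m_0)$, $\varepsilon(m_{-1})m_0=\alpha(m)$. (Left-left) Hom-Yetter-Drinfeld module over a Hom-bialgebra $(H,\beta)$: a quadruple $(M,\rhd_M,\rho^M,\alpha_M)$ such that $(M,\rhd_M,\alpha_M)$ is a left $(H,\beta)$-Hom-module, $(M,\rho^M,\alpha_M)$ is a left $(H,\beta)$-Hom-comodule, and for all $h\in H$, $m\in M$ $$h_1\beta(m_{-1})\otimes(\beta^3(h_2)\rhd_M m_0)=(\beta^2(h_1)\rhd_M m)_{-1}h_2\otimes(\beta^2(h_1)\rhd_M m)_0 .$$ *)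

(* Defs.v *)
From HB Require Import structures.
From mathcomp Require Import all_boot all_algebra sesquilinear.
From mathcomp Require Import boolp.
From mathcomp.multinomials Require Import freeg.

Set Implicit Arguments.
Unset Strict Implicit.
Unset Printing Implicit Defensive.

Import GRing.Theory.
Local Open Scope ring_scope.
Local Open Scope quotient_scope.

Notation is_bilinear f := (bilinear_for *:%R *:%R f).

(* Tensor product of two vector spaces: the quotient of the free vector space
   {freeg (U * V) / K} by the subspace generated by the bilinearity relations. *)
Section Tensor.
Variables (K : fieldType) (U V : lmodType K).
Implicit Types (x y : {freeg (U * V)%type / K}).

Inductive tensor_rel : {freeg (U * V)%type / K} -> Prop :=
| tensor_rel0 : tensor_rel 0
| tensor_relD x y of tensor_rel x & tensor_rel y : tensor_rel (x + y)
| tensor_relZ a x of tensor_rel x : tensor_rel (a *: x)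
| tensor_rel_addl u u' v :
    tensor_rel (<<(u + u', v)>> - <<(u, v)>> - <<(u', v)>>)
| tensor_rel_addr u v v' :
    tensor_rel (<<(u, v + v')>> - <<(u, v)>> - <<(u, v')>>)
| tensor_rel_scalel a u v :
    tensor_rel (<<(a *: u, v)>> - a *: <<(u, v)>>)
| tensor_rel_scaler a u v :
    tensor_rel (<<(u, a *: v)>> - a *: <<(u, v)>>).

Definition tensor_equiv x y : bool := `[< tensor_rel (x - y) >].

Lemma tensor_equiv_refl : reflexive tensor_equiv.
Proof. by move=> x; apply/asboolP; rewrite subrr; exact: tensor_rel0. Qed.

Lemma tensor_equiv_sym : symmetric tensor_equiv.
Proof.
suff imp x y : tensor_equiv x y -> tensor_equiv y x.
  by move=> x y; apply/idP/idP; exact: imp.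
move=> /asboolP xy; apply/asboolP.
by rewrite -opprB -scaleN1r; exact: tensor_relZ.
Qed.

Lemma tensor_equiv_trans : transitive tensor_equiv.
Proof.
move=> y x z /asboolP xy /asboolP yz; apply/asboolP.
by have := tensor_relD xy yz; rewrite addrA subrK.
Qed.

Canonical tensor_equiv_equiv :=
  EquivRel tensor_equiv tensor_equiv_refl tensor_equiv_sym tensor_equiv_trans.
Canonical tensor_equiv_direct := defaultEncModRel tensor_equiv.

Definition tensor : Type := {eq_quot tensor_equiv}.
HB.instance Definition _ : EqQuotient _ tensor_equiv tensor :=
  EqQuotient.on tensor.
HB.instance Definition _ := Choice.on tensor.

Lemma tensor_eqP x y : reflect (tensor_rel (x - y)) (x == y %[mod tensor]).
Proof. by rewrite eqmodE; exact: asboolP. Qed.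

Definition tpi (x : {freeg (U * V)%type / K}) : tensor := \pi_tensor x.

Lemma tpiP x y : tensor_rel (x - y) -> tpi x = tpi y.
Proof. by move=> xy; apply/eqP/tensor_eqP. Qed.

Lemma tpi_repr t : tpi (repr t) = t.
Proof. exact: reprK. Qed.

Lemma tpiW (P : tensor -> Prop) : (forall x, P (tpi x)) -> forall t, P t.
Proof. by move=> Ppi t; rewrite -(tpi_repr t). Qed.

Lemma repr_rel x : tensor_rel (repr (tpi x) - x).
Proof. by apply/tensor_eqP; rewrite reprK. Qed.

Definition tadd (s t : tensor) : tensor := tpi (repr s + repr t).
Definition topp (t : tensor) : tensor := tpi (- repr t).
Definition tscale (a : K) (t : tensor) : tensor := tpi (a *: repr t).

Lemma tpiD x y : tadd (tpi x) (tpi y) = tpi (x + y).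
Proof.
apply: tpiP; rewrite opprD addrACA.
by apply: tensor_relD; exact: repr_rel.
Qed.

Lemma tpiN x : topp (tpi x) = tpi (- x).
Proof.
apply: tpiP; rewrite -opprD -scaleN1r.
by apply: tensor_relZ; exact: repr_rel.
Qed.

Lemma tpiZ a x : tscale a (tpi x) = tpi (a *: x).
Proof.
by apply: tpiP; rewrite -scalerBr; apply: tensor_relZ; exact: repr_rel.
Qed.

Lemma taddA : associative tadd.
Proof. by elim/tpiW=> x; elim/tpiW=> y; elim/tpiW=> z; rewrite !tpiD addrA. Qed.
Lemma taddC : commutative tadd.
Proof. by elim/tpiW=> x; elim/tpiW=> y; rewrite !tpiD addrC. Qed.
Lemma tadd0 : left_id (tpi 0) tadd.
Proof. by elim/tpiW=> ?; rewrite tpiD add0r. Qed.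
Lemma taddN : left_inverse (tpi 0) topp tadd.
Proof. by elim/tpiW=> ?; rewrite tpiN tpiD addNr. Qed.

HB.instance Definition _ := GRing.isZmodule.Build tensor taddA taddC tadd0 taddN.

Lemma tpi_add x y : tpi x + tpi y = tpi (x + y).
Proof. exact: tpiD. Qed.

Lemma tscaleA a b t : tscale a (tscale b t) = tscale (a * b) t.
Proof. by elim/tpiW: t => ?; rewrite !tpiZ scalerA. Qed.
Lemma tscale1 : left_id 1 tscale.
Proof. by elim/tpiW=> ?; rewrite tpiZ scale1r. Qed.
Lemma tscaleDr : right_distributive tscale +%R.
Proof.
by move=> a; elim/tpiW=> x; elim/tpiW=> y; rewrite !(tpiZ, tpi_add) scalerDr.
Qed.
Lemma tscaleDl t : {morph tscale^~ t : a b / a + b}.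
Proof. by move=> a b; elim/tpiW: t => ?; rewrite !(tpiZ, tpi_add) scalerDl. Qed.

HB.instance Definition _ :=
  GRing.Zmodule_isLmodule.Build K tensor tscaleA tscale1 tscaleDr tscaleDl.

Lemma tpi_linear : linear tpi.
Proof. by move=> a x y; rewrite -tpi_add -tpiZ. Qed.

Definition tpure (u : U) (v : V) : tensor := tpi <<(u, v)>>.

End Tensor.

Notation "U ⊗ V" := (tensor U V)
  (at level 40, left associativity) : type_scope.
Notation "u ⊗ v" := (tpure u v)
  (at level 40, left associativity) : ring_scope.

(* For t = \sum_i u_i ⊗ v_i, the sum \sum_i F u_i v_i.  When F is bilinear it
   does not depend on how t is written (tsum_pure, tsum_linear); for other F the
   value is that at an arbitrarily chosen representative of t. *)
Definition tsum (K : fieldType) (U V W : lmodType K) (F : U -> V -> W)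
    (t : (U ⊗ V)%type) : W :=
  \sum_(p <- dom (repr t)) coeff p (repr t) *: F p.1 p.2.

Notation "\tsum_ ( u ⊗ v <- t ) E" := (tsum (fun u v => E) t)
  (at level 41, u name, v name, E at level 41,
   format "'[' \tsum_ ( u  ⊗  v  <-  t ) '/  '  E ']'") : ring_scope.

Section TensorTheory.
Variables (K : fieldType) (U V : lmodType K).

Lemma tpure_bilinear : is_bilinear (@tpure K U V).
Proof.
split=> [v|u] a x y; rewrite /tpure -tpi_linear; apply: tpiP.
- have := tensor_relD (tensor_rel_addl (a *: x) y v) (tensor_rel_scalel a x v).
  by rewrite addrACA subrK -opprD [X in _ - X]addrC.
- have := tensor_relD (tensor_rel_addr u (a *: x) y) (tensor_rel_scaler a u x).
  by rewrite addrACA subrK -opprD [X in _ - X]addrC.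
Qed.

HB.instance Definition _ :=
  bilinear_isBilinear.Build K U V (U ⊗ V)%type *:%R *:%R (@tpure K U V)
    tpure_bilinear.

Variable W : lmodType K.
Implicit Types (F : U -> V -> W) (x : {freeg (U * V)%type / K}).

Let flat F x : W := \sum_(p <- dom x) coeff p x *: F p.1 p.2.

Let fgl F : {additive {freeg (U * V)%type / K} -> W} :=
  HB.pack (fglift (fun p : U * V => F p.1 p.2))
    (GRing.isZmodMorphism.Build _ _ _ (lift_is_additive _)).

Let flatE F x : flat F x = fgl F x.
Proof.
rewrite -[in RHS](freeg_sumE x) raddf_sum; apply: eq_bigr => p _.
by rewrite /= liftU.
Qed.

Let flatU F a p : flat F <<a *g p>> = a *: F p.1 p.2.
Proof. by rewrite flatE /= liftU. Qed.

Let freegZ a b (p : U * V) : a *: <<b *g p>> = <<a * b *g p>> :> {freeg _ / K}.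
Proof. by apply/eqP/freeg_eqP => q; rewrite coeffZ !coeffU mulrA. Qed.

Let flat_linear F : linear (flat F).
Proof.
move=> a x y; rewrite !flatE raddfD; congr (_ + _).
rewrite -(freeg_sumE x) scaler_sumr !raddf_sum.
by apply: eq_bigr => p _; rewrite freegZ /= !liftU scalerA.
Qed.

Let flat_rel F x : is_bilinear F -> tensor_rel x -> flat F x = 0.
Proof.
move=> [Fl Fr].
pose f : {linear _ -> W} :=
  HB.pack (flat F) (GRing.isLinear.Build _ _ _ _ _ (flat_linear F)).
have fU u v : f <<(u, v)>> = F u v by rewrite /= flatU scale1r.
have Fl0 v : F 0 v = 0 by have := Fl v (-1) 0 0; rewrite /= !scaleN1r !addNr.
have Fr0 u : F u 0 = 0 by have := Fr u (-1) 0 0; rewrite /= !scaleN1r !addNr.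
rewrite (_ : flat F x = f x) //; move: f fU => f fU; elim=> {x} [|x y _ x0 _ y0|a x _ x0|u u' v|u v v'|a u v|a u v].
- by rewrite linear0.
- by rewrite linearD x0 y0 addr0.
- by rewrite linearZ_LR x0 scaler0.
- by rewrite !linearB !fU -[u]scale1r Fl /= !scale1r addrAC addrK subrr.
- by rewrite !linearB !fU -[v]scale1r Fr /= !scale1r addrAC addrK subrr.
- by rewrite linearB linearZ_LR !fU -[a *: u]addr0 Fl Fl0 addr0 subrr.
- by rewrite linearB linearZ_LR !fU -[a *: v]addr0 Fr Fr0 addr0 subrr.
Qed.

Lemma tsum_pi F x : is_bilinear F -> tsum F (tpi x) = flat F x.
Proof.
move=> Fbil; apply/eqP; rewrite -subr_eq0 -scaleN1r addrC -flat_linear.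
by rewrite addrC scaleN1r flat_rel //; exact: repr_rel.
Qed.

Lemma tsum_pure F u v : is_bilinear F -> tsum F (u ⊗ v) = F u v.
Proof. by move=> Fbil; rewrite tsum_pi // flatU scale1r. Qed.

Lemma tsum_linear F : is_bilinear F -> linear (tsum F).
Proof.
move=> Fbil a; elim/tpiW=> x; elim/tpiW=> y.
by rewrite -tpi_linear !tsum_pi // flat_linear.
Qed.

Lemma tensor_ext (f g : {linear (U ⊗ V)%type -> W}) :
  (forall u v, f (u ⊗ v) = g (u ⊗ v)) -> f =1 g.
Proof.
move=> fg; elim/tpiW=> x.
pose p : {linear {freeg (U * V)%type / K} -> (U ⊗ V)%type} :=
  HB.pack (@tpi K U V) (GRing.isLinear.Build _ _ _ _ _ (@tpi_linear K U V)).
have pU u v : p <<(u, v)>> = u ⊗ v by [].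
rewrite (_ : tpi x = p x) //; move: p pU => p pU.
rewrite -(freeg_sumE x) !linear_sum; apply: eq_bigr => -[u v] _.
by rewrite -[coeff _ _]mulr1 -freegZ !linearZ_LR pU fg.
Qed.

End TensorTheory.

(* The sum is linear in any parameter on which F depends linearly. *)
Lemma tsum_param (K : fieldType) (U V W X : lmodType K)
    (F : X -> U -> V -> W) (t : (U ⊗ V)%type) :
  (forall u v, linear (fun x => F x u v)) -> linear (fun x => tsum (F x) t).
Proof.
move=> Flin a x y; rewrite /tsum scaler_sumr -big_split; apply: eq_bigr => p _.
by rewrite Flin scalerDr !scalerA mulrC.
Qed.

Section TensorMaps.
Variables (K : fieldType).

Section Map.
Variables (U U' V V' : lmodType K).
Variables (f : {linear U -> U'}) (g : {linear V -> V'}).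

Definition tmap (t : (U ⊗ V)%type) : (U' ⊗ V')%type :=
  \tsum_(u ⊗ v <- t) f u ⊗ g v.

Lemma tmap_bilinear : is_bilinear (fun u v => f u ⊗ g v).
Proof.
by split=> [v|u] a x y; rewrite linearP ?(linearPl, linearPr).
Qed.

HB.instance Definition _ :=
  GRing.isLinear.Build K (U ⊗ V)%type (U' ⊗ V')%type *:%R tmap
    (tsum_linear tmap_bilinear).

Lemma tmapE u v : tmap (u ⊗ v) = f u ⊗ g v.
Proof. exact: tsum_pure tmap_bilinear. Qed.

End Map.

Section Assoc.
Variables (U V W : lmodType K).

Definition tassoc (t : (U ⊗ V ⊗ W)%type) : (U ⊗ (V ⊗ W))%type :=
  \tsum_(uv ⊗ w <- t) \tsum_(u ⊗ v <- uv) u ⊗ (v ⊗ w).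

Definition tassocV (t : (U ⊗ (V ⊗ W))%type) : (U ⊗ V ⊗ W)%type :=
  \tsum_(u ⊗ vw <- t) \tsum_(v ⊗ w <- vw) u ⊗ v ⊗ w.

Lemma tassoc_bilinear0 (w : W) : is_bilinear (fun (u : U) (v : V) => u ⊗ (v ⊗ w)).
Proof. by split=> [v|u] a x y; rewrite ?linearPl ?linearPr. Qed.

Lemma tassoc_bilinear :
  is_bilinear (fun uv (w : W) => \tsum_(u ⊗ v <- uv) (u : U) ⊗ ((v : V) ⊗ w)).
Proof.
split=> [w|uv]; first exact/tsum_linear/tassoc_bilinear0.
by apply: tsum_param => u v a x y; rewrite !linearPr.
Qed.

Lemma tassocV_bilinear0 (u : U) :
  is_bilinear (fun (v : V) (w : W) => u ⊗ v ⊗ w).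
Proof. by split=> [w|v] a x y; rewrite ?linearPl ?linearPr ?linearPl. Qed.

Lemma tassocV_bilinear :
  is_bilinear (fun (u : U) vw => \tsum_(v ⊗ w <- vw) u ⊗ (v : V) ⊗ (w : W)).
Proof.
split=> [vw|u]; last exact/tsum_linear/tassocV_bilinear0.
by apply: tsum_param => v w a x y; rewrite !linearPl.
Qed.

HB.instance Definition _ :=
  GRing.isLinear.Build K (U ⊗ V ⊗ W)%type (U ⊗ (V ⊗ W))%type *:%R tassoc
    (tsum_linear tassoc_bilinear).
HB.instance Definition _ :=
  GRing.isLinear.Build K (U ⊗ (V ⊗ W))%type (U ⊗ V ⊗ W)%type *:%R tassocV
    (tsum_linear tassocV_bilinear).

Lemma tassocE u v w : tassoc (u ⊗ v ⊗ w) = u ⊗ (v ⊗ w).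
Proof.
by rewrite /tassoc (tsum_pure _ _ tassoc_bilinear) (tsum_pure _ _ (tassoc_bilinear0 _)).
Qed.

Lemma tassocVE u v w : tassocV (u ⊗ (v ⊗ w)) = u ⊗ v ⊗ w.
Proof.
by rewrite /tassocV (tsum_pure _ _ tassocV_bilinear) (tsum_pure _ _ (tassocV_bilinear0 _)).
Qed.

End Assoc.

End TensorMaps.

Arguments tassoc {K} U V W t.
Arguments tassocV {K} U V W t.

(* In the sums below, c1, c2, c11, ... are Sweedler components; m1 and m0 stand
   for m_{-1} and m_0, m01 and m00 for m_{0 -1} and m_{0 0}, and m11 and m12 for
   m_{-1 1} and m_{-1 2}.  All the summands are bilinear. *)
Section HomStructures.
Variable K : fieldType.

Record is_hom_algebra (A : lmodType K) (mu : {linear (A ⊗ A)%type -> A})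
    (one : A) (alpha : {linear A -> A}) : Prop := IsHomAlgebra {
  hom_alg_bij : bijective alpha;
  hom_alg_mul : forall a b, alpha (mu (a ⊗ b)) = mu (alpha a ⊗ alpha b);
  hom_alg_one : alpha one = one;
  hom_alg_assoc : forall a b c,
    mu (alpha a ⊗ mu (b ⊗ c)) = mu (mu (a ⊗ b) ⊗ alpha c);
  hom_alg_mul1 : forall a, mu (a ⊗ one) = alpha a;
  hom_alg_1mul : forall a, mu (one ⊗ a) = alpha a
}.

Record is_hom_coalgebra (C : lmodType K) (Delta : {linear C -> (C ⊗ C)%type})
    (eps : {scalar C}) (beta : {linear C -> C}) : Prop := IsHomCoalgebra {
  hom_coalg_bij : bijective beta;
  hom_coalg_comul : forall c,
    Delta (beta c) = \tsum_(c1 ⊗ c2 <- Delta c) beta c1 ⊗ beta c2;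
  hom_coalg_counit : forall c, eps (beta c) = eps c;
  hom_coalg_coassoc : forall c,
    \tsum_(c1 ⊗ c2 <- Delta c) \tsum_(c21 ⊗ c22 <- Delta c2)
       beta c1 ⊗ (c21 ⊗ c22)
    = \tsum_(c1 ⊗ c2 <- Delta c) \tsum_(c11 ⊗ c12 <- Delta c1)
       c11 ⊗ (c12 ⊗ beta c2);
  hom_coalg_counitl : forall c,
    \tsum_(c1 ⊗ c2 <- Delta c) eps c1 *: c2 = beta c;
  hom_coalg_counitr : forall c,
    \tsum_(c1 ⊗ c2 <- Delta c) eps c2 *: c1 = beta c
}.

Record homBialgebra := HomBialgebra {
  hb_sort :> lmodType K;
  hb_mul : {linear (hb_sort ⊗ hb_sort)%type -> hb_sort};
  hb_one : hb_sort;
  hb_comul : {linear hb_sort -> (hb_sort ⊗ hb_sort)%type};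
  hb_counit : {scalar hb_sort};
  hb_beta : {linear hb_sort -> hb_sort};
  hb_algebra : is_hom_algebra hb_mul hb_one hb_beta;
  hb_coalgebra : is_hom_coalgebra hb_comul hb_counit hb_beta;
  hb_comulM : forall h h',
    hb_comul (hb_mul (h ⊗ h'))
    = \tsum_(h1 ⊗ h2 <- hb_comul h) \tsum_(h1' ⊗ h2' <- hb_comul h')
       hb_mul (h1 ⊗ h1') ⊗ hb_mul (h2 ⊗ h2');
  hb_comul1 : hb_comul hb_one = hb_one ⊗ hb_one;
  hb_counitM : forall h h',
    hb_counit (hb_mul (h ⊗ h')) = hb_counit h * hb_counit h';
  hb_counit1 : hb_counit hb_one = 1
}.

Section Modules.
Variable H : homBialgebra.
Local Notation "x ∙ y" := (hb_mul H (x ⊗ y))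
  (at level 38, left associativity).
Local Notation Delta := (hb_comul H).
Local Notation beta := (hb_beta H).

Record is_hom_module (M : lmodType K) (act : {linear (H ⊗ M)%type -> M})
    (alpha : {linear M -> M}) : Prop := IsHomModule {
  hom_mod_bij : bijective alpha;
  hom_mod_alpha : forall h m, alpha (act (h ⊗ m)) = act (beta h ⊗ alpha m);
  hom_mod_assoc : forall h h' m,
    act (beta h ⊗ act (h' ⊗ m)) = act ((h ∙ h') ⊗ alpha m);
  hom_mod_unit : forall m, act (hb_one H ⊗ m) = alpha m
}.

Record is_hom_comodule (M : lmodType K) (rho : {linear M -> (H ⊗ M)%type})
    (alpha : {linear M -> M}) : Prop := IsHomComodule {
  hom_comod_bij : bijective alpha;
  hom_comod_alpha : forall m,
    rho (alpha m) = \tsum_(m1 ⊗ m0 <- rho m) beta m1 ⊗ alpha m0;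
  hom_comod_coassoc : forall m,
    \tsum_(m1 ⊗ m0 <- rho m) \tsum_(m01 ⊗ m00 <- rho m0)
       beta m1 ⊗ (m01 ⊗ m00)
    = \tsum_(m1 ⊗ m0 <- rho m) \tsum_(m11 ⊗ m12 <- Delta m1)
       m11 ⊗ (m12 ⊗ alpha m0);
  hom_comod_counit : forall m,
    \tsum_(m1 ⊗ m0 <- rho m) hb_counit H m1 *: m0 = alpha m
}.

Record homYDModule := HomYDModule {
  yd_sort :> lmodType K;
  yd_act : {linear (H ⊗ yd_sort)%type -> yd_sort};
  yd_coact : {linear yd_sort -> (H ⊗ yd_sort)%type};
  yd_alpha : {linear yd_sort -> yd_sort};
  yd_module : is_hom_module yd_act yd_alpha;
  yd_comodule : is_hom_comodule yd_coact yd_alpha;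
  yd_compat : forall h m,
    \tsum_(h1 ⊗ h2 <- Delta h) \tsum_(m1 ⊗ m0 <- yd_coact m)
       (h1 ∙ beta m1) ⊗ yd_act (iter 3 beta h2 ⊗ m0)
    = \tsum_(h1 ⊗ h2 <- Delta h)
      \tsum_(x1 ⊗ x0 <- yd_coact (yd_act (iter 2 beta h1 ⊗ m)))
       (x1 ∙ h2) ⊗ x0
}.

Section Tau.
Variables M N : homYDModule.

Definition tau (t : (M ⊗ N)%type) : (N ⊗ M)%type :=
  \tsum_(m ⊗ n <- t) \tsum_(m1 ⊗ m0 <- yd_coact M m)
    yd_act N (iter 3 beta m1 ⊗ n) ⊗ m0.

Lemma iter_linear (V : lmodType K) (f : {linear V -> V}) k : linear (iter k f).
Proof. by elim: k => [|k IH] a x y //=; rewrite IH linearP. Qed.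

Lemma tau_bilinear0 n :
  is_bilinear (fun (h : H) (m : M) => yd_act N (iter 3 beta h ⊗ (n : N)) ⊗ m).
Proof.
split=> [m|h] a x y; last by rewrite linearPr.
by rewrite iter_linear linearPl linearP linearPl.
Qed.

Lemma tau_bilinear :
  is_bilinear (fun (m : M) (n : N) => \tsum_(m1 ⊗ m0 <- yd_coact M m)
                 yd_act N (iter 3 beta m1 ⊗ n) ⊗ m0).
Proof.
split=> [n|m].
  by move=> a x y; rewrite linearP (tsum_linear (tau_bilinear0 n)).
by apply: tsum_param => h m0 a x y; rewrite linearPr linearP linearPl.
Qed.

HB.instance Definition _ :=
  GRing.isLinear.Build K (M ⊗ N)%type (N ⊗ M)%type *:%R tau
    (tsum_linear tau_bilinear).

Lemma tauE m n :
  tau (m ⊗ n) =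
  \tsum_(m1 ⊗ m0 <- yd_coact M m) yd_act N (iter 3 beta m1 ⊗ n) ⊗ m0.
Proof. exact: tsum_pure tau_bilinear. Qed.

End Tau.
End Modules.
End HomStructures.

Arguments tau {K H} M N t.

(* Main.v *)
(* Both sides, evaluated at m ⊗ (n ⊗ p), become sums over m_{-1} ⊗ m_0 and
   h_1 ⊗ h_2 = Δ(m_{-1}): on the left Hom-coassociativity of the coaction
   replaces β(m_{-1}) ⊗ m_{0 -1} ⊗ m_{0 0} by m_{-1 1} ⊗ m_{-1 2} ⊗ α(m_0) in
   the iterated coaction on m; on the right the same step leaves the coaction on
   β^2(h_1) ▷ n, up to α.  The two summands are then the two sides of the
   Yetter-Drinfeld condition for h = m_{-1} and n, under the linear map
   k ⊗ x |-> (β^3(k) ▷ α^2(p)) ⊗ α(x) ⊗ α^2(m_0). *)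
From HB Require Import structures.
Require Import Defs.
From mathcomp Require Import all_boot all_algebra.
From mathcomp Require Import sesquilinear.

Import GRing.Theory.
Local Open Scope ring_scope.

(** * Calculus of sums over tensors *)

Section TensorSums.
Set Implicit Arguments.
Unset Strict Implicit.
Variable K : fieldType.
Implicit Types U V W X : lmodType K.

Lemma eq_tsum U V W (F G : U -> V -> W) t : F =2 G -> tsum F t = tsum G t.
Proof. by move=> FG; apply: eq_bigr => p _; rewrite FG. Qed.

(** Each side is a finite double sum over the chosen representatives of [s] and [t], with scalars
    that commute. *)
Lemma exchange_tsum U V U' V' W (F : U -> V -> U' -> V' -> W) s t :
  \tsum_(u ⊗ v <- s) \tsum_(u' ⊗ v' <- t) F u v u' v' =
  \tsum_(u' ⊗ v' <- t) \tsum_(u ⊗ v <- s) F u v u' v'.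
Proof.
rewrite /tsum; under eq_bigr do rewrite scaler_sumr.
rewrite exchange_big; apply: eq_bigr => q _; rewrite scaler_sumr.
by apply: eq_bigr => p _; rewrite !scalerA mulrC.
Qed.

(** Linearity is a proof argument, so that maps without a declared linear structure, such as
    [fun w => w ⊗ x] or [tsum F], are covered. *)
Lemma tsum_map_linear U V W X (f : W -> X) (F : U -> V -> W) t :
  linear f -> f (tsum F t) = \tsum_(u ⊗ v <- t) f (F u v).
Proof.
move=> f_lin; pose g : {linear W -> X} :=
  HB.pack f (GRing.isLinear.Build _ _ _ _ _ f_lin).
rewrite -[f _]/(g _) linear_sum; apply: eq_bigr => p _.
by rewrite linearZ_LR.
Qed.

Lemma linear_tsum U V W X (f : {linear W -> X}) (F : U -> V -> W) t :
  f (tsum F t) = \tsum_(u ⊗ v <- t) f (F u v).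
Proof. by apply: tsum_map_linear => a x y; rewrite linearP. Qed.

Lemma tpure_tsuml U V W X (F : U -> V -> W) t (x : X) :
  tsum F t ⊗ x = \tsum_(u ⊗ v <- t) F u v ⊗ x.
Proof. by apply: (tsum_map_linear (f := fun w : W => w ⊗ x)) => a u v; rewrite linearPl. Qed.

Lemma tpure_tsumr U V W X (F : U -> V -> W) t (x : X) :
  x ⊗ tsum F t = \tsum_(u ⊗ v <- t) x ⊗ F u v.
Proof. by apply: (tsum_map_linear (f := fun w : W => x ⊗ w)) => a u v; rewrite linearPr. Qed.

(** Two linear maps that agree on pure tensors are equal. This writes any tensor as a sum of pure
    ones. *)
Lemma tsum_tpure U V (t : (U ⊗ V)%type) : tsum (@tpure K U V) t = t.
Proof.
pose f : {linear (U ⊗ V)%type -> (U ⊗ V)%type} :=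
  HB.pack (tsum (@tpure K U V))
    (GRing.isLinear.Build _ _ _ _ _ (tsum_linear (@tpure_bilinear K U V))).
apply: (tensor_ext (f := f) (g := idfun)) => u v.
exact: tsum_pure (@tpure_bilinear K U V).
Qed.

Lemma tsum_tsum U V U' V' W (F : U' -> V' -> W) (G : U -> V -> (U' ⊗ V')%type) t :
  is_bilinear F ->
  tsum F (tsum G t) = \tsum_(u ⊗ v <- t) tsum F (G u v).
Proof. by move=> /tsum_linear; exact: tsum_map_linear. Qed.

Lemma tensor_ext3 U V W X (f g : {linear (U ⊗ (V ⊗ W))%type -> X}) :
  (forall u v w, f (u ⊗ (v ⊗ w)) = g (u ⊗ (v ⊗ w))) -> f =1 g.
Proof.
move=> fg; apply: tensor_ext => u t.
rewrite -(tsum_tpure t) tpure_tsumr !linear_tsum /=.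
by apply: eq_tsum => v w; exact: fg.
Qed.

End TensorSums.

Ltac solve_linear :=
  by move=> ? ? ?; rewrite /= ?(linearP, linearPl, linearPr).
Ltac solve_bilinear :=
  by split=> ? ? ? ? /=; rewrite ?(linearP, linearPl, linearPr).

(** * Hom-Yetter-Drinfeld modules and the two sides of the Hom-Yang-Baxter equation *)

Section YetterDrinfeld.
Set Implicit Arguments.
Unset Strict Implicit.
Variables (K : fieldType) (H : homBialgebra K).
Implicit Types (M N P : homYDModule H) (X : lmodType K).
Local Notation "x ∙ y" := (hb_mul H (x ⊗ y))
  (at level 38, left associativity).
Local Notation Delta := (hb_comul H).
Local Notation beta := (hb_beta H).

(** Here and in the next two lemmas, a linear map is applied to an axiom between tensors, which
    makes the axiom usable under any multilinear summand. *)
Lemma tsum_coact_alpha M X (F : H -> M -> X) m : is_bilinear F ->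
  \tsum_(m1 ⊗ m0 <- yd_coact M (yd_alpha M m)) F m1 m0 =
  \tsum_(m1 ⊗ m0 <- yd_coact M m) F (beta m1) (yd_alpha M m0).
Proof.
move=> F_bil; rewrite (hom_comod_alpha (yd_comodule M)) tsum_tsum //.
by apply: eq_tsum => m1 m0; rewrite tsum_pure.
Qed.

Lemma tsum_coact_coassoc M X (F : H -> H -> M -> X) m :
  (forall h, is_bilinear (F h)) ->
  (forall h' x, linear (fun h => F h h' x)) ->
  \tsum_(m1 ⊗ m0 <- yd_coact M m) \tsum_(m01 ⊗ m00 <- yd_coact M m0)
    F (beta m1) m01 m00
  = \tsum_(m1 ⊗ m0 <- yd_coact M m) \tsum_(m11 ⊗ m12 <- Delta m1)
      F m11 m12 (yd_alpha M m0).
Proof.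
move=> F_bil F_lin.
(* The two hypotheses make [F] trilinear, so it induces a linear map on [H ⊗ (H ⊗ M)]. *)
have bil : is_bilinear (fun h t => tsum (F h) t).
  by split=> [t|h]; [exact: tsum_param | exact: tsum_linear].
have := congr1 (tsum (fun h t => tsum (F h) t))
  (hom_comod_coassoc (yd_comodule M) m).
rewrite !tsum_tsum //; under eq_tsum => m1 m0.
  rewrite tsum_tsum //; under eq_tsum => m01 m00 do rewrite !tsum_pure //.
  over.
under [RHS]eq_tsum => m1 m0.
  rewrite tsum_tsum //; under eq_tsum => m01 m00 do rewrite !tsum_pure //.
  over.
by [].
Qed.

Lemma tsum_yd_compat M X (F : H -> M -> X) h m : is_bilinear F ->
  \tsum_(h1 ⊗ h2 <- Delta h) \tsum_(m1 ⊗ m0 <- yd_coact M m)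
    F (h1 ∙ beta m1) (yd_act M (iter 3 beta h2 ⊗ m0))
  = \tsum_(h1 ⊗ h2 <- Delta h)
    \tsum_(x1 ⊗ x0 <- yd_coact M (yd_act M (iter 2 beta h1 ⊗ m)))
      F (x1 ∙ h2) x0.
Proof.
move=> F_bil; have := congr1 (tsum F) (yd_compat h m).
rewrite !tsum_tsum //; under eq_tsum => m1 m0.
  rewrite tsum_tsum //; under eq_tsum => m01 m00 do rewrite !tsum_pure //.
  over.
under [RHS]eq_tsum => m1 m0.
  rewrite tsum_tsum //; under eq_tsum => m01 m00 do rewrite !tsum_pure //.
  over.
by [].
Qed.

Lemma tau_alphal M N m n :
  tau M N (yd_alpha M m ⊗ n) =
  \tsum_(m1 ⊗ m0 <- yd_coact M m)
    yd_act N (iter 4 beta m1 ⊗ n) ⊗ yd_alpha M m0.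
Proof. by rewrite tauE tsum_coact_alpha //; exact: tau_bilinear0. Qed.

(** The coaction commutes with α, which adds one β on m_{-1}; then β^4(m_{-1}) ▷ α(n) =
    α(β^3(m_{-1}) ▷ n). *)
Lemma tau_alpha M N m n :
  tau M N (yd_alpha M m ⊗ yd_alpha N n) =
  tmap (yd_alpha N) (yd_alpha M) (tau M N (m ⊗ n)).
Proof.
rewrite tau_alphal tauE linear_tsum; apply: eq_tsum => m1 m0 /=.
by rewrite tmapE (hom_mod_alpha (yd_module N)).
Qed.

Lemma hom_act_act M h h' m :
  yd_alpha M (yd_act M (beta h ⊗ yd_act M (h' ⊗ m))) =
  yd_act M (beta (h ∙ h') ⊗ yd_alpha M (yd_alpha M m)).
Proof. by rewrite (hom_mod_assoc (yd_module M)) (hom_mod_alpha (yd_module M)). Qed.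

Lemma hom_betaM h h' : beta (h ∙ h') = beta h ∙ beta h'.
Proof. exact: hom_alg_mul (hb_algebra H) h h'. Qed.

(** The right-hand side isolates [h1 ∙ beta n1] and [iter 3 beta h2] acting on [n0], the two factors
    on the left of the Yetter-Drinfeld condition. *)
Lemma yang_baxter_left M N P m n p :
  tmap (yd_alpha P) (tau M N) (tassoc P M N
    (tmap (tau M P) (yd_alpha N) (tassocV M P N
      (yd_alpha M m ⊗ tau N P (n ⊗ p))))) =
  \tsum_(m1 ⊗ m0 <- yd_coact M m) \tsum_(h1 ⊗ h2 <- Delta m1)
    \tsum_(n1 ⊗ n0 <- yd_coact N n)
      yd_act P (iter 3 beta (h1 ∙ beta n1) ⊗ yd_alpha P (yd_alpha P p)) ⊗
        (yd_alpha N (yd_act N (iter 3 beta h2 ⊗ n0)) ⊗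
         yd_alpha M (yd_alpha M m0)).
Proof.
rewrite tauE tpure_tsumr [tassocV _ _ _ _]linear_tsum.
rewrite [tmap (tau M P) _ _]linear_tsum [tassoc _ _ _ _]linear_tsum.
rewrite [tmap _ _ _]linear_tsum /=.
under eq_tsum => n1 n0.
  rewrite tassocVE tmapE /= tau_alphal tpure_tsuml [tassoc _ _ _ _]linear_tsum.
  rewrite [tmap _ _ _]linear_tsum /=.
  under eq_tsum => m1 m0.
    rewrite tassocE tmapE /= tau_alphal tpure_tsumr.
    rewrite /= hom_act_act.
    over.
  over.
under eq_tsum => n1 n0.
  (* [F] has one β fewer on its first argument: the missing one is the β of β(m_{-1}) in
     Hom-coassociativity. *)
  rewrite (tsum_coact_coassoc (F := fun h h' x =>
    yd_act P (beta (beta (beta h) ∙ iter 3 beta n1) ⊗ yd_alpha P (yd_alpha P p))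
      ⊗ (yd_act N (iter 4 beta h' ⊗ yd_alpha N n0) ⊗ yd_alpha M x))); last first.
  - move=> ? ?; solve_linear.
  - move=> h; solve_bilinear.
  over.
(* The sum over the coaction on [n] moves innermost, as in the Yetter-Drinfeld condition. *)
rewrite exchange_tsum; apply: eq_tsum => m1 m0.
rewrite exchange_tsum; apply: eq_tsum => h1 h2; apply: eq_tsum => n1 n0.
by rewrite /= !hom_betaM (hom_mod_alpha (yd_module N)).
Qed.

Lemma yang_baxter_right M N P m n p :
  tassoc P N M (tmap (tau N P) (yd_alpha M) (tassocV N P M
    (tmap (yd_alpha N) (tau M P) (tassoc N M P
      (tau M N (m ⊗ n) ⊗ yd_alpha P p))))) =
  \tsum_(m1 ⊗ m0 <- yd_coact M m) \tsum_(h1 ⊗ h2 <- Delta m1)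
    \tsum_(n1 ⊗ n0 <- yd_coact N (yd_act N (iter 2 beta h1 ⊗ n)))
      yd_act P (iter 3 beta (n1 ∙ h2) ⊗ yd_alpha P (yd_alpha P p)) ⊗
        (yd_alpha N n0 ⊗ yd_alpha M (yd_alpha M m0)).
Proof.
rewrite tauE tpure_tsuml [tassoc N M P _]linear_tsum.
rewrite [tmap _ (tau M P) _]linear_tsum [tassocV _ _ _ _]linear_tsum.
rewrite [tmap _ _ _]linear_tsum [tassoc _ _ _ _]linear_tsum /=.
under eq_tsum => m1 m0.
  rewrite tassocE tmapE /= tauE tpure_tsumr [tassocV _ _ _ _]linear_tsum.
  rewrite [tmap _ _ _]linear_tsum [tassoc _ _ _ _]linear_tsum /=.
  (* Moving α_N inside the action gives β^4(m_{-1}) = β^3(β(m_{-1})), the form that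
     Hom-coassociativity needs. *)
  rewrite (hom_mod_alpha (yd_module N)).
  under eq_tsum => m01 m00.
    rewrite tassocVE tmapE.
    over.
  over.
(* [tau N P] stays unexpanded, so the linearity of [F] follows from that of [tau]. *)
rewrite (tsum_coact_coassoc (F := fun h h' x => tassoc P N M
  (tau N P (yd_act N (iter 3 beta h ⊗ yd_alpha N n) ⊗
            yd_act P (iter 3 beta h' ⊗ yd_alpha P p)) ⊗ yd_alpha M x))); last first.
- move=> ? ?; solve_linear.
- move=> h; solve_bilinear.
apply: eq_tsum => m1 m0; apply: eq_tsum => h1 h2.
(* β^3(h1) ▷ α(n) = α(β^2(h1) ▷ n); taking this α through the coaction leaves the coaction on
   β^2(h1) ▷ n. *)
rewrite /= -(hom_mod_alpha (yd_module N)) tau_alphal tpure_tsuml.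
rewrite [tassoc _ _ _ _]linear_tsum; apply: eq_tsum => n1 n0 /=.
by rewrite tassocE (hom_mod_assoc (yd_module P)) !hom_betaM.
Qed.

Lemma yang_baxter_sums M N P m n p :
  tmap (yd_alpha P) (tau M N) (tassoc P M N
    (tmap (tau M P) (yd_alpha N) (tassocV M P N
      (tmap (yd_alpha M) (tau N P) (m ⊗ (n ⊗ p)))))) =
  tassoc P N M (tmap (tau N P) (yd_alpha M) (tassocV N P M
    (tmap (yd_alpha N) (tau M P) (tassoc N M P
      (tmap (tau M N) (yd_alpha P) (tassocV M N P (m ⊗ (n ⊗ p)))))))).
Proof.
rewrite tassocVE !tmapE yang_baxter_left yang_baxter_right.
apply: eq_tsum => m1 m0.
(* [p] and [m0] are only parameters of [F]; the condition concerns [m1] and [n]. *)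
rewrite (tsum_yd_compat (F := fun h x =>
  yd_act P (iter 3 beta h ⊗ yd_alpha P (yd_alpha P p)) ⊗
    (yd_alpha N x ⊗ yd_alpha M (yd_alpha M m0)))) //.
solve_bilinear.
Qed.

End YetterDrinfeld.

Theorem proposition4p3 (K : fieldType) (H : homBialgebra K)
    (M N : homYDModule H) :
  tau M N \o tmap (yd_alpha M) (yd_alpha N)
    =1 tmap (yd_alpha N) (yd_alpha M) \o tau M N
  /\
  forall P : homYDModule H,
    (tmap (yd_alpha P) (tau M N) \o tassoc P M N \o
     tmap (tau M P) (yd_alpha N) \o tassocV M P N \o
     tmap (yd_alpha M) (tau N P)
     : (M ⊗ (N ⊗ P))%type -> (P ⊗ (N ⊗ M))%type)
    =1
    (tassoc P N M \o tmap (tau N P) (yd_alpha M) \o tassocV N P M \o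
     tmap (yd_alpha N) (tau M P) \o tassoc N M P \o
     tmap (tau M N) (yd_alpha P) \o tassocV M N P).
Proof.
split=> [|P].
  by apply: tensor_ext => m n; rewrite /= !tmapE tau_alpha.
by apply: tensor_ext3 => m n p; exact: yang_baxter_sums.
Qed.
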